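(* Let $A$ be a Boolean algebra. The following conditions are equivalent: (i) $A$ is atomic; (ii) $A$ is order pre-compact; (iii) $A$ is order locally pre-compact.
   Context: $A$ is a Boolean algebra with least element $0$ and greatest element $1$. For $p\le q$ in $A$ the order interval is $[p,q]=\{r\in A : p\le r\le q\}$. An element $a\in A$ is an atom if $a>0$ and $[0,a]=\{0,a\}$; $A$ is atomic if for every $b>0$ the interval $[0,b]$ contains an atom. A filter on a set $\Omega$ is a (proper, nonempty) filter of subsets of $\Omega$; an ultrafilter is a maximal such filter. A filter $\mathcal{F}$ on $A$ order converges to $p\in A$ if $\mathcal{F}$ contains a collection of order intervals whose intersection is $\{p\}$. Equivalently, in terms of nets: $(p_\alpha)$ order converges to $p$ if there are an increasing net $(q_\beta)_{\beta\in B}$ and a decreasing net $(r_\beta)_{\beta\in B}$ with $\bigvee_\beta q_\beta=p=\bigwedge_\beta r_\beta$ such that for every $\beta$ there is $\alpha_0$ with $q_\beta\le p_\alpha\le r_\beta$ for all $\alpha\ge\alpha_0$; a filter order converges to $p$ iff it is generated by the tails of a net that order converges to $p$. Let $a-b$ denote the symmetric difference in $A$, and for $X,Y\subseteq A$ let $X-Y=\{x-y : x\in X, y\in Y\}$. A filter $\mathcal{F}$ on $A$ is order Cauchy if the filter generated by $\{X-Y : X,Y\in\mathcal{F}\}$ order converges to $0$ (for nets: $(p_\alpha-p_\beta)_{(\alpha,\beta)}$ order converges to $0$). A subset $S\subseteq A$ is order pre-compact if every ultrafilter on $A$ that contains $S$ is order Cauchy (equivalently, every net in $S$ has a subnet that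 is order Cauchy in $A$); in particular, $A$ is order pre-compact if every ultrafilter on $A$ is order Cauchy. $A$ is order locally pre-compact if every order convergent filter on $A$ contains an order pre-compact set. *)

(* Defs.v *)
From mathcomp Require Import all_boot all_order.
From mathcomp Require Import interval boolp classical_sets set_interval filter.
Set Implicit Arguments.
Unset Strict Implicit.
Unset Printing Implicit Defensive.

Local Open Scope order_scope.
Local Open Scope classical_set_scope.

Section OrderConvergence.
Context {d : Order.disp_t} {A : ctbDistrLatticeType d}.
Implicit Types (F : set_system A) (S X Y : set A) (a b p : A).

Definition is_atom a := \bot < a /\ `[\bot, a] = [set \bot; a].

Definition is_order_interval X :=
  exists q r : A, q <= r /\ X = `[q, r].

(* The collection of intervals may be infinite; F is only closed under finite
   intersections, so {p} itself need not belong to F. *)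
Definition order_cvg F p :=
  exists I : set (set A),
    [/\ I `<=` F, I `<=` is_order_interval & \bigcap_(X in I) X = [set p]].

Definition symdiff a b : A := ((a `\` b) `|` (b `\` a))%O.

Definition set_symdiff X Y : set A :=
  [set symdiff x y | x in X & y in Y].

Definition diff_filter F : set_system A :=
  smallest Filter [set set_symdiff X Y | X in F & Y in F].

Definition order_cauchy F := order_cvg (diff_filter F) \bot.

Definition order_precompact S :=
  forall F, UltraFilter F -> F S -> order_cauchy F.

End OrderConvergence.

Definition atomic {d : Order.disp_t} (A : ctbDistrLatticeType d) :=
  forall b : A, \bot < b -> exists2 a : A, is_atom a & `[\bot, b] a.

Definition order_locally_precompact {d : Order.disp_t}
    (A : ctbDistrLatticeType d) :=
  forall F : set_system A, ProperFilter F ->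
    (exists p : A, order_cvg F p) -> exists2 S : set A, F S & order_precompact S.

(* Main.v *)
Require Import Defs.
From mathcomp Require Import all_boot all_order.
From mathcomp Require Import finmap.
From mathcomp Require Import interval boolp classical_sets set_interval filter.

(** If [A] is atomic and [F] is an ultrafilter on [A], then for every atom [a]
    some member of [F] consists of elements all above [a] or all disjoint from
    [a]; differences of its elements lie in [[0, ~a]], and these intervals
    intersect in [{0}].
    Conversely, let there be no atom below [b > 0].  For [0 < r <= b], finitely
    many sets of the form [{x | x `&` c = e}], [0 < c <= r], never cover
    [[0, r]]; an ultrafilter on [[0, r]] avoiding all of them is not order
    Cauchy, so [[0, r]] is not order pre-compact.  On the other hand a Boolean
    ultrafilter of elements below [b] has infimum [0], so the intervals [[0, r]]
    with [r] in it generate a filter that order converges to [0]. *)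

Set Implicit Arguments.
Unset Strict Implicit.
Unset Printing Implicit Defensive.

Import Order.TTheory Order.CTheory.
Local Open Scope classical_set_scope.
Local Open Scope order_scope.

Lemma ex_ultra_finI (T : Type) (I : choiceType) (P : I -> set T) :
  (forall s : seq I, exists x, forall i, i \in s -> P i x) ->
  exists2 G : set_system T, UltraFilter G & forall i, G (P i).
Proof.
move=> Pfin; have finIP : finI [set: I] P.
  by move=> D _; have [x Px] := Pfin D; exists x => i /= iD; exact: Px.
have [G [GU sub]] := ultraFilterLemma (finI_filter finIP).
by exists G => // i; apply: sub; exists (P i) => //; exact: finI_from1.
Qed.

Lemma itv0E (d : Order.disp_t) (A : ctbDistrLatticeType d) (r x : A) :
  `[\bot, r]%classic x = (x <= r) :> Prop.
Proof. by rewrite /= in_itv /= le0x. Qed.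

Section Diff.
Context {d : Order.disp_t} {A : ctbDistrLatticeType d}.
Implicit Types (F : set_system A) (X : set A) (a b r u x y : A).

(** Both sides say that [x] and [y] agree modulo the principal ideal of [u]. *)
Lemma symdiff_leP x y u :
  symdiff x y <= u <-> x `&` ~` u = y `&` ~` u.
Proof.
have diff_le z t : (z `\` t <= u) = (z `&` ~` u <= t `&` ~` u).
  by rewrite lexI leIr andbT -diffE !leBLR joinC.
by rewrite /symdiff leUx !diff_le; split=> [/le_anti|->] //; rewrite lexx.
Qed.

(** Sets of the form [Z - Z] suffice as a base, because [X - Y] contains the differences of [X] and
    [Y] intersected. *)
Lemma diff_filterP F X : Filter F ->
  diff_filter F X <-> exists2 Z, F Z & set_symdiff Z Z `<=` X.
Proof.
rewrite /diff_filter => FF; split; last first.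
  move=> [Z FZ ZX] C [CF CS]; apply: (filterS ZX); apply: CS.
  by exists Z => //; exists Z.
move: X; apply: smallest_sub.
  split.
  - by exists setT => //; exact: filterT.
  - move=> X Y [Z1 FZ1 sub1] [Z2 FZ2 sub2].
    exists (Z1 `&` Z2)%classic; first exact: filterI.
    move=> _ [x [x1 x2] [y [y1 y2] <-]]; split.
      by apply: sub1; exists x => //; exists y.
    by apply: sub2; exists x => //; exists y.
  - by move=> X Y XY [Z FZ ZX]; exists Z => //; exact: subset_trans ZX XY.
move=> _ [X FX [Y FY <-]]; exists (X `&` Y)%classic; first exact: filterI.
by move=> _ [x [xX _] [y [_ yY] <-]]; exists x => //; exists y.
Qed.

Lemma atom_disj a x : is_atom a -> ~~ (a <= x) -> a `&` x = \bot.
Proof.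
move=> [_ aE] nax; have : `[\bot, a]%classic (a `&` x) by rewrite itv0E leIl.
by rewrite aE => -[//|ax]; rewrite -ax leIr in nax.
Qed.

Lemma atomic_precompact : atomic A -> order_precompact [set: A].
Proof.
move=> Aat F FU _.
exists [set `[\bot, (~` a)%O]%classic | a in is_atom]; split.
- move=> _ [a aa <-].
  have [Z FZ Za] : exists2 Z, F Z &
      forall x y, Z x -> Z y -> x `&` a = y `&` a.
    have [Fa|Fa] := in_ultra_setVsetC [set x | a <= x] FU;
      eexists; try exact: Fa.
      by move=> x y /= ax ay; rewrite !(meet_r _).
    move=> x y /= /negP nax /negP nay.
    by rewrite -!(meetC a) !atom_disj.
  apply/diff_filterP; exists Z => // _ [x Zx [y Zy <-]].
  by rewrite itv0E; apply/symdiff_leP; rewrite complK; exact: Za.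
- by move=> _ [a _ <-]; exists \bot, (~` a); split=> //; exact: le0x.
- apply/seteqP; split=> [x xI|_ -> _ [a _ <-]]; last by rewrite itv0E le0x.
  apply/eqP; rewrite -[_ == _]negbK -lt0x; apply/negP => x0.
  have [a aa] := Aat _ x0; rewrite itv0E => ax.
  have := xI _ (imageP _ aa); rewrite itv0E => xa.
  have := le_trans ax xa; rewrite -disj_leC meetxx => /eqP a0.
  by case: aa; rewrite a0 ltxx.
Qed.

Lemma precompact_locally_precompact :
  order_precompact [set: A] -> order_locally_precompact A.
Proof. by move=> Apc F FF _; exists setT => //; exact: filterT. Qed.

Definition atomless r :=
  forall p, \bot < p -> p <= r -> exists2 q, \bot < q & q < p.

Lemma atomlessW r u : u <= r -> atomless r -> atomless u.
Proof. by move=> ur rna p p0 /le_trans - /(_ _ ur); exact: rna. Qed.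

Lemma no_atom_atomless r :
  ~ (exists2 a, is_atom a & `[\bot, r]%classic a) -> atomless r.
Proof.
move=> na p p0 pr; apply: contrapT => nq; apply: na; exists p; last first.
  by rewrite itv0E.
split=> //; apply/seteqP; split=> [x|x [->|->]]; rewrite itv0E ?le0x //.
rewrite le_eqVlt => /orP[/eqP ->|xp]; first by right.
left; apply/eqP; rewrite -[_ == _]negbK -lt0x; apply/negP => x0.
by apply: nq; exists x.
Qed.

Lemma disjoint_refinement r n (c : nat -> A) : atomless r ->
  (forall i, (i < n)%N -> \bot < c i <= r) ->
  exists2 f : nat -> A, forall i, (i < n)%N -> \bot < f i <= c i &
    forall i j, (i < n)%N -> (j < n)%N -> i != j -> f i `&` f j = \bot.
Proof.
move=> rna; elim: n => [|n IHn] cP; first by exists (fun=> \bot).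
have [f fP fD] := IHn (fun i ni => cP i (ltnW ni)).
(* It is enough to fix the [n]-th piece and shrink the others. *)
suff [g [gn gf gnD]] : exists g : nat -> A, [/\ \bot < g n <= c n,
    forall i, (i < n)%N -> \bot < g i <= f i &
    forall i, (i < n)%N -> g i `&` g n = \bot].
  exists g => [i|i j].
    rewrite ltnS leq_eqVlt => /orP[/eqP -> //|ni].
    have /andP[-> gi] := gf _ ni; have /andP[_ fi] := fP _ ni.
    exact: le_trans gi fi.
  rewrite ltnS leq_eqVlt => /predU1P[->|ni];
    rewrite ltnS leq_eqVlt => /predU1P[->|nj] ij.
  - by rewrite eqxx in ij.
  - by rewrite meetC gnD.
  - exact: gnD.
  have /andP[_ gi] := gf _ ni; have /andP[_ gj] := gf _ nj.
  by apply/eqP; rewrite -lex0 -(fD i j ni nj ij) leI2.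
have /andP[cn0 cnr] := cP n (ltnSn n).
have [[i ni fc]|nfc] := pselect (exists2 i, (i < n)%N & \bot < f i `&` c n);
    last first.
  exists (fun j => if j == n then c n else f j); split=> [|j nj|j nj].
  - by rewrite eqxx cn0 lexx.
  - by rewrite ltn_eqF // lexx andbT; have /andP[] := fP _ nj.
  rewrite eqxx ltn_eqF //; apply/eqP; rewrite -[_ == _]negbK -lt0x.
  by apply/negP => fc; apply: nfc; exists j.
(* Strictness of [q] leaves [f i] minus [q] nonzero; lying below [f i], [q] is already disjoint from
   every other piece. *)
have [q q0 qfc] := rna _ fc (le_trans (leIr _ _) cnr).
have /andP[qf qc] : (q <= f i) && (q <= c n) by rewrite -lexI ltW.
exists (fun j => if j == n then q else if j == i then f i `\` q else f j).
split=> [|j nj|j nj].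
- by rewrite eqxx q0.
- rewrite ltn_eqF //; case: eqP => [->|_]; last first.
    by rewrite lexx andbT; have /andP[] := fP _ nj.
  by rewrite leBx andbT lt0B // (lt_le_trans qfc) // leIl.
rewrite eqxx ltn_eqF //; case: eqP => [_|/eqP ji]; first by rewrite diffIK.
by apply/eqP; rewrite -lex0 -(fD j i nj ni ji) leI2.
Qed.

(** A diagonal argument: on disjoint nonzero pieces [f i <= c i], let [x] be the complement of [e i]
    relative to [f i]. Then [x] differs from [e i] on [f i], hence on [c i]. *)
Lemma avoid_slices r (s : seq (A * A)) : atomless r ->
  (forall t, t \in s -> \bot < t.1 <= r) ->
  exists2 x, x <= r & forall t, t \in s -> x `&` t.1 <> t.2.
Proof.
move=> rna sr; pose c i := (nth (\bot, \bot) s i).1.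
pose e i := (nth (\bot, \bot) s i).2.
have [i si|f fP fD] := @disjoint_refinement r (size s) c rna.
  by apply: sr; exact: mem_nth.
exists (\join_(i < size s) (f i `\` e i)).
  apply/joinsP => i _; apply: le_trans (leBx _ _) _.
  have /andP[_ fc] := fP _ (ltn_ord i).
  by apply: le_trans fc _;
    have /andP[] := sr _ (mem_nth (\bot, \bot) (ltn_ord i)).
move=> t /(nthP (\bot, \bot))[i si <-]; rewrite -/(c i) -/(e i).
set x := \join_(_ < _) _ => xE; have /andP[f0 fc] := fP _ si.
have fx : f i `\` e i <= x by exact: (@joins_sup _ _ _ (Ordinal si) xpredT).
have xfe : x <= ~` (f i `&` e i).
  apply/joinsP => j _; rewrite -disj_leC.
  have [->|ji] := eqVneq (val j) i; first by rewrite meetC meetIB.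
  rewrite -lex0 -(fD j i (ltn_ord j) si ji).
  by apply: leI2; [exact: leBx|exact: leIl].
(* If [x] met [c i] in [e i], then [f i] minus [e i] would lie below [e i] and so vanish. This puts
   [f i] below both [x] and its complement. *)
have fe : f i <= e i.
  rewrite -diff_eq0 -lex0 -[leRHS](diffKI (f i) (e i)) lexI lexx andbT.
  by rewrite -[leRHS]xE lexI fx; exact: le_trans (leBx _ _) fc.
have : f i <= x by apply: le_trans fe _; rewrite -[leLHS]xE leIl.
move=> /le_trans /(_ xfe); rewrite (meet_l fe) -disj_leC meetxx => /eqP f00.
by rewrite f00 ltxx in f0.
Qed.

Lemma atomless_not_precompact r :
  \bot < r -> atomless r -> ~ order_precompact `[\bot, r]%classic.
Proof.
move=> r0 rna rpc.
pose P (t : A * A) := [set x | x <= r /\ (\bot < t.1 <= r -> x `&` t.1 <> t.2)].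
have [s|G GU GP] := @ex_ultra_finI _ _ P.
  have [|x xr xs] := @avoid_slices r [seq t <- s | \bot < t.1 <= r] rna.
    by move=> t; rewrite mem_filter => /andP[].
  by exists x => t ts; split=> // tr; apply: xs; rewrite mem_filter tr.
have [|I [IG Iitv IE]] := rpc G GU.
  (* Any index will do here: only the bound [x <= r] is extracted. *)
  by apply: filterS (GP (\bot, \bot)) => x [xr _]; rewrite itv0E.
suff : (\bigcap_(X in I) X) r by rewrite IE => rE; rewrite rE ltxx in r0.
move=> X IX; have [q [u [qu XE]]] := Iitv _ IX.
have /diff_filterP[Z GZ] := IG _ IX; rewrite XE => ZX.
have : X \bot by have : (\bigcap_(X in I) X) \bot by [rewrite IE|]; exact.
rewrite XE /= !in_itv /= lex0 => /andP[/eqP -> _]; rewrite le0x /=.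
apply: contrapT => /negP nru.
(* Differences of members of [Z] lie below [u], so all members have the same meet with [r] minus
   [u]. Thus [Z] lies in a single slice, which [G] avoids. *)
have c0 : \bot < r `\` u by rewrite lt0x diff_eq0.
have [z Zz] := filter_ex GZ.
have [x [Zx [_ /=]]] := filter_ex (filterI GZ (GP (r `\` u, z `&` (r `\` u)))).
rewrite c0 leBx; apply=> //.
have : `[q, u]%classic (symdiff x z) by apply: ZX; exists x => //; exists z.
rewrite /= in_itv /= => /andP[_ /symdiff_leP xz].
by rewrite diffE !(meetC r) !meetA xz.
Qed.

(** Meet [x] with each [c] in turn unless the result is zero; shrinking [x] preserves earlier
    decisions. *)
Lemma decide_seq b (s : seq A) : \bot < b ->
  exists2 x, \bot < x <= b & forall c, c \in s -> x <= c \/ x `&` c = \bot.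
Proof.
move=> b0; elim: s => [|c s [x /andP[x0 xb] xs]].
  by exists b; rewrite ?b0 /=.
have [xc|xc] := posxP (x `&` c).
  exists x; first by rewrite x0.
  by move=> y; rewrite inE => /orP[/eqP -> |/xs]; [right|].
exists (x `&` c); first by rewrite xc (le_trans (leIl _ _)).
move=> y; rewrite inE => /orP[/eqP ->|/xs [xy|xy]]; first by left; exact: leIr.
  by left; exact: le_trans (leIl _ _) xy.
by right; rewrite meetAC xy meet0x.
Qed.

Lemma locally_precompact_atomic : order_locally_precompact A -> atomic A.
Proof.
move=> Alpc b b0; apply: contrapT => /no_atom_atomless bna.
pose P c := [set x | \bot < x <= b /\ (x <= c \/ x `&` c = \bot)].
have [s|G GU GP] := @ex_ultra_finI _ _ P.
  by have [x x0 xs] := decide_seq s b0; exists x => c cs; split=> //; exact: xs.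
(* [U] is an ultrafilter of the Boolean algebra [A] that contains [b]. *)
pose U := [set u : A | G [set x | x <= u]].
have Ub : U b by apply: filterS (GP b) => x [/andP[]].
have UI u v : U u -> U v -> U (u `&` v).
  move=> Uu Uv; apply: filterS (filterI Uu Uv) => x [/= xu xv].
  by rewrite lexI xu.
have U0 u : U u -> \bot < u.
  move=> Uu; have [x [xu [/andP[x0 _] _]]] := filter_ex (filterI Uu (GP u)).
  exact: lt_le_trans x0 xu.
have Udec c : U c \/ U (~` c).
  have [Uc|nUc] := in_ultra_setVsetC [set x | x <= c] GU; [by left|right].
  apply: filterS (filterI nUc (GP c)) => x [/= nxc [_ [//|]]].
  by rewrite -disj_leC => ->.
have Uinf p : (forall u, U u -> p <= u) -> p = \bot.
  move=> pU; apply/eqP; rewrite -[_ == _]negbK -lt0x; apply/negP => p0.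
  (* [U] contains [q] or its complement, and [p] would lie below it; the first contradicts [q < p],
     the second makes [q] disjoint from itself. *)
  have [q q0 qp] := bna _ p0 (pU _ Ub).
  have [/pU pq|/pU pq] := Udec q.
    by have := lt_le_trans qp pq; rewrite ltxx.
  have := le_trans (ltW qp) pq; rewrite -disj_leC meetxx => /eqP qE.
  by rewrite qE ltxx in q0.
pose F := filter_from U (fun u => `[\bot, u]%classic).
have FF : ProperFilter F.
  apply: filter_from_proper; last first.
    by move=> u _; exists \bot; rewrite itv0E le0x.
  apply: filter_from_filter; first by exists b.
  move=> u v Uu Uv; exists (u `&` v); first exact: UI.
  by move=> x; rewrite itv0E lexI => /andP[xu xv]; split; rewrite itv0E.
have [|S [u Uu uS] Spc] := Alpc F FF.
  exists \bot, [set `[\bot, u]%classic | u in U]; split.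
  - by move=> _ [u Uu <-]; exists u.
  - by move=> _ [u _ <-]; exists \bot, u; split=> //; exact: le0x.
  apply/seteqP; split=> [p pI|_ -> _ [u _ <-]]; last by rewrite itv0E le0x.
  by apply: Uinf => u Uu; have := pI _ (imageP _ Uu); rewrite itv0E.
(* Meeting [u] with [b] gives a nonzero atomless element whose interval is still inside [S], and
   pre-compactness passes to subsets. *)
have /U0 ub0 := UI _ _ Uu Ub.
apply: (atomless_not_precompact ub0 (atomlessW (leIr _ _) bna)) => H HU HS.
apply: Spc; apply: filterS HS; apply: subset_trans uS => x.
by rewrite !itv0E => /le_trans; apply; exact: leIl.
Qed.

End Diff.

Theorem theorem3p2 (d : Order.disp_t) (A : ctbDistrLatticeType d) :
  (atomic A <-> order_precompact [set: A]%classic) /\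
  (order_precompact [set: A]%classic <-> order_locally_precompact A).
Proof.
split; split.
- exact: atomic_precompact.
- by move=> /precompact_locally_precompact; exact: locally_precompact_atomic.
- exact: precompact_locally_precompact.
- by move=> /locally_precompact_atomic; exact: atomic_precompact.
Qed.
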